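(* Let $G$ be an infinite, connected, countable, locally finite $d$-regular graph. For any starting vertex and any initial port, the random basic walk on $G$ cycles with probability $1$.
   Context: Each undirected edge $\{v,w\}$ is regarded as two arcs $v\to w$ and $w\to v$. A labeling assigns, at each vertex $v$ of degree $\deg(v)$, the port numbers $1,\dots,\deg(v)$ bijectively to the arcs leaving $v$ (labels on $v\to w$ and $w\to v$ need not agree). In a random labeling these bijections are chosen uniformly at random, independently for different vertices. Given a labeling, a starting vertex $v_0$ and an initial port $\ell$, the basic walk leaves $v_0$ along the arc labeled $\ell$; thereafter, whenever it enters a vertex $v$ along an arc whose label is $i$, it leaves $v$ along the arc out of $v$ labeled $(i \bmod \deg(v))+1$. The random basic walk is the basic walk for a random labeling. The walk cycles if some arc is traversed twice in the same direction (equivalently, from some point on it is periodic and visits only finitely many vertices); it is transient otherwise. *)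

(* Defs.v *)
From HB Require Import structures.
From mathcomp Require Import all_boot all_order all_algebra all_fingroup.
From mathcomp Require Import all_classical all_reals.
From mathcomp Require Import measure.

Set Implicit Arguments.
Unset Strict Implicit.
Unset Printing Implicit Defensive.

(* Graphs.  A (simple, locally finite) graph on a countable vertex type V  *)
(* is given by its neighbour lists  N v : seq V  (a fixed enumeration of   *)
(* the neighbours of v, used only to name the arcs leaving v).             *)

Definition simple_graph (V : eqType) (N : V -> seq V) : Prop :=
  [/\ forall v, uniq (N v),
      forall v, v \notin N v &
      forall v w, w \in N v -> v \in N w].

Definition regular (V : eqType) (N : V -> seq V) (d : nat) : Prop :=
  forall v, size (N v) = d.

Definition connected_graph (V : eqType) (N : V -> seq V) : Prop :=
  forall v w, exists p : seq V,
    path (fun x y => y \in N x) v p /\ last v p = w.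

Definition infinite_type (V : eqType) : Prop :=
  forall s : seq V, exists v, v \notin s.

(* Labelings of a d-regular graph.  Ports are 0-based: the port k : 'I_d  *)
(* stands for the paper's label k+1.  A labeling assigns to every vertex  *)
(* v a permutation sigma_v of 'I_d; the arc leaving v with label k goes to *)
(* the neighbour  nth v (N v) (sigma_v k).  Since N v enumerates the d     *)
(* neighbours of v without repetition, this is a bijection between ports  *)
(* and arcs leaving v, and a uniform permutation gives a uniform bijection.*)

Definition labeling (V : Type) (d : nat) := V -> {perm 'I_d}.

Definition port_target (V : eqType) (N : V -> seq V) (d : nat)
    (L : labeling V d) (v : V) (k : 'I_d) : V :=
  nth v (N v) (L v k).

(* Basic walk.  The state at time n is (x_n, p_n): the current vertex and  *)
(* the label of the arc along which the walk leaves it at step n.          *)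
(* Initially (v0, l).  The walk leaves x_n along the arc labeled p_n,      *)
(* i.e. it enters x_{n+1} along an arc whose label is p_n, hence leaves    *)
(* x_{n+1} along the arc labeled (p_n mod d) + 1, i.e. ordS p_n (0-based). *)
Fixpoint walk_state (V : eqType) (N : V -> seq V) (d : nat)
    (L : labeling V d) (v0 : V) (l : 'I_d) (n : nat) : V * 'I_d :=
  match n with
  | 0 => (v0, l)
  | n'.+1 =>
      let: (x, p) := walk_state N L v0 l n' in
      (port_target N L x p, ordS p)
  end.

Definition walk_arc (V : eqType) (N : V -> seq V) (d : nat)
    (L : labeling V d) (v0 : V) (l : 'I_d) (n : nat) : V * V :=
  let: (x, p) := walk_state N L v0 l n in (x, port_target N L x p).

Definition walk_cycles (V : eqType) (N : V -> seq V) (d : nat)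
    (L : labeling V d) (v0 : V) (l : 'I_d) : Prop :=
  exists n m, (n < m)%N /\ walk_arc N L v0 l n = walk_arc N L v0 l m.

(* Random labeling: a family (L omega v)_{v in V} of random permutations   *)
(* of 'I_d on a probability space, mutually independent and uniform:       *)
(* every finite family of distinct vertices takes any prescribed values    *)
(* with probability (1/d!)^k.                                              *)
Local Open Scope classical_set_scope.
Local Open Scope ring_scope.

Definition random_labeling (V : eqType) (d : nat) (dsp : measure_display)
    (Omega : measurableType dsp) (R : realType) (P : probability Omega R)
    (L : Omega -> labeling V d) : Prop :=
  (forall v (s : {perm 'I_d}), measurable [set w | L w v = s]) /\
  (forall (vs : seq V) (s : V -> {perm 'I_d}), uniq vs ->
     P [set w | forall v, v \in vs -> L w v = s v]
       = (((d`!)%:R : R)^-1 ^+ size vs)%:E).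

(* Main.v *)
Require Import Defs.
From HB Require Import structures.
From mathcomp Require Import all_boot all_order all_algebra all_fingroup.
From mathcomp Require Import all_classical all_reals.
From mathcomp Require Import measure.
From mathcomp Require Import topology normedtype sequences lra.

(* When the walk discovers a new vertex [u], coming from [a] through port [i],
   relabelling only [u] and its neighbours suffices to make it cycle at once:
   let port [i - 1] of [u] lead to [a], and let a neighbour [b <> a] reached
   from [u] through port [q] lead back to [u] through port [q + 1], unless that
   port of [b] was already used.  The walk then oscillates around [u] until it
   either repeats a state at [u], hits an already used state of a neighbour, or
   leaves [u] through port [i - 1] and finds the old state [(a, i)].
   The past of the walk is unchanged and the relabelling is at most
   [(d!)^(d+1)]-to-one, so visiting [d + 1] more vertices multiplies the
   probability by at most [1 - (d!)^-(d+1)].  A walk that never cycles visits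
   at least [k] vertices in its first [k d] steps, for every [k]. *)

Set Implicit Arguments.
Unset Strict Implicit.
Unset Printing Implicit Defensive.

Import Order.TTheory GRing.Theory Num.Theory.

Lemma card_perm_ord n : #|{perm 'I_n}| = n`!.
Proof.
have := card_perm [set: 'I_n]; rewrite cardsT card_ord => <-.
by apply: eq_card => s; rewrite !inE; apply/esym/fintype.subsetP.
Qed.

(** * Ports, neighbours and redirected ports *)

Section Walk.
Variables (V : choiceType) (N : V -> seq V) (d : nat).
Hypotheses (Hsimple : simple_graph N) (Hreg : regular N d).
Implicit Types (L : labeling V d) (u v w : V) (p q : 'I_d).

Let N_uniq v : uniq (N v). Proof. by case: Hsimple. Qed.
Let N_irr v : v \notin N v. Proof. by case: Hsimple. Qed.
Let N_sym v w : w \in N v -> v \in N w.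
Proof. by case: Hsimple => _ _; apply. Qed.

Lemma port_target_in L v p : port_target N L v p \in N v.
Proof. by rewrite mem_nth // Hreg. Qed.

Lemma port_target_inj L v : injective (port_target N L v).
Proof.
move=> p q /eqP; rewrite nth_uniq ?Hreg // => /eqP /val_inj.
exact: perm_inj.
Qed.

Lemma port_targetP L v w : w \in N v -> exists p, port_target N L v p = w.
Proof.
move=> wv; have iw : index w (N v) < d by rewrite -(Hreg v) index_mem.
exists ((L v)^-1 (Ordinal iw))%g.
by rewrite /port_target permKV nth_index.
Qed.

Definition port_to L v w (p0 : 'I_d) : 'I_d :=
  odflt p0 [pick p | port_target N L v p == w].

Lemma port_toK L v w p0 : w \in N v -> port_target N L v (port_to L v w p0) = w.
Proof.
move=> wv; rewrite /port_to; case: pickP => [p /eqP //|no].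
by have [p /eqP] := port_targetP L wv; rewrite no.
Qed.

(** Swapping two ports keeps the labeling at [v] bijective. For a neighbour [w], port [p] now leads
    to [w], the port that led to [w] inherits the old target of [p], and every other port is
    unchanged. *)
Definition redirect L v p w : {perm 'I_d} :=
  (tperm p (port_to L v w p) * L v)%g.

Lemma redirectE L v p w q :
  nth v (N v) (redirect L v p w q) =
  port_target N L v (tperm p (port_to L v w p) q).
Proof. by rewrite /redirect permM. Qed.

(** * The walk as iteration on states, and the count of visited vertices *)

Section Start.
Variables (v0 : V) (l : 'I_d).

Notation state L n := (walk_state N L v0 l n).

Definition step L (s : V * 'I_d) := (port_target N L s.1 s.2, ordS s.2).

Lemma walk_stateS L n : state L n.+1 = step L (state L n).
Proof. by rewrite /step /=; case: (state L n). Qed.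

Definition visited L n := [seq (state L i).1 | i <- iota 0 n].
Definition past L n := [seq state L i | i <- iota 0 n].
Definition nvisited L n := size (undup (visited L n)).

Lemma visitedS L n : visited L n.+1 = rcons (visited L n) (state L n).1.
Proof. by rewrite /visited -addn1 iotaD map_cat cats1. Qed.

Lemma mem_visited L m n : m < n -> (state L m).1 \in visited L n.
Proof. by move=> mn; apply/mapP; exists m; rewrite // mem_iota. Qed.

Lemma mem_past L m n : m < n -> state L m \in past L n.
Proof. by move=> mn; apply/mapP; exists m; rewrite // mem_iota. Qed.

Lemma pastP L n s : reflect (exists2 m, m < n & s = state L m) (s \in past L n).
Proof.
apply: (iffP mapP) => [[m]|[m mn ->]]; last by exists m; rewrite // mem_iota.
by rewrite mem_iota add0n => /= mn ->; exists m.
Qed.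

Lemma nvisited_leq L m n : m <= n -> nvisited L m <= nvisited L n.
Proof.
move=> mn; apply: uniq_leq_size; first exact: undup_uniq.
move=> x; rewrite !mem_undup => /mapP[i]; rewrite mem_iota add0n => /= im ->.
exact/mem_visited/(leq_trans im).
Qed.

(** Since [visited L n] stops at time [n - 1], this says that the vertex at time [n] is the [k]-th
    distinct one. *)
Definition discovers L k n := nvisited L n < k <= nvisited L n.+1.

Lemma discovers_new L k n :
  discovers L k n -> (state L n).1 \notin visited L n.
Proof.
move=> /andP[nk kn]; apply/negP => xn.
suff : nvisited L n.+1 <= nvisited L n by rewrite leqNgt (leq_trans nk).
apply: uniq_leq_size; first exact: undup_uniq.
by move=> x; rewrite !mem_undup visitedS mem_rcons inE => /orP[/eqP->|].
Qed.

Lemma discovers_inj L k m n : discovers L k m -> discovers L k n -> m = n.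
Proof.
wlog mn : m n / m <= n => [th|/andP[_ km] /andP[nk _]].
  by case/orP: (leq_total m n) => mn Hm Hn; [exact: th|apply/esym; exact: th].
apply/eqP; rewrite eqn_leq mn leqNgt; apply/negP => mn'.
by have := leq_trans km (nvisited_leq L mn'); rewrite leqNgt nk.
Qed.

Lemma discovers_exists L k T : 0 < k -> k <= nvisited L T ->
  exists2 n, n < T & discovers L k n.
Proof.
move=> k0; elim: T => [|T IH]; first by rewrite leqNgt k0.
move=> kT; have [kT'|Tk] := leqP k (nvisited L T).
  by have [n nT Hn] := IH kT'; exists n; rewrite // ltnS ltnW.
by exists T; rewrite // /discovers Tk.
Qed.

Lemma eq_walk_state L L' n :
  (forall m, m < n -> port_target N L' (state L m).1 (state L m).2 =
                      port_target N L (state L m).1 (state L m).2) ->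
  forall m, m <= n -> state L' m = state L m.
Proof.
move=> E; elim=> [//|m IH mn].
by rewrite !walk_stateS IH ?(ltnW mn) // /step E.
Qed.

Lemma eq_nvisited L L' n :
  (forall m, m < n -> state L' m = state L m) -> nvisited L' n = nvisited L n.
Proof.
move=> E; congr (size (undup _)); apply/eq_in_map => m.
by rewrite mem_iota add0n => /= /E ->.
Qed.

(** * Trapping the walk around a newly discovered vertex *)

Section Relabel.
Variables (L : labeling V d) (n : nat).

Let u := (state L n.+1).1.
Let a := (state L n).1.
Let i := (state L n).2.
Let back := redirect L u (ord_pred i) a.
(** The port by which the walk leaves [b] after coming from [u]. It depends on the labeling at [u]
    alone, so the constant labeling [back] can stand in for [relabel], not yet defined. *)
Let port_in (b : V) := ordS (port_to (fun=> back) u b i).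

Definition relabel : labeling V d := fun b =>
  if b == u then back
  else if [&& b \in N u, b != a & (b, port_in b) \notin past L n.+1]
  then redirect L b (port_in b) u else L b.

Hypothesis u_new : u \notin visited L n.+1.

Let uE : u = port_target N L a i.
Proof. by rewrite /u walk_stateS. Qed.

Let a_u : a \in N u.
Proof. by apply: N_sym; rewrite uE port_target_in. Qed.

Lemma relabel_off b : b \notin u :: N u -> relabel b = L b.
Proof.
by rewrite inE negb_or /relabel => /andP[/negPf -> /negPf ->].
Qed.

Let past_neq_u s : s \in past L n.+1 -> s.1 != u.
Proof.
case/pastP=> m mn ->; apply: contraNneq u_new => <-; exact: mem_visited.
Qed.

Let relabel_past s : s \in past L n.+1 ->
  port_target N relabel s.1 s.2 = port_target N L s.1 s.2.
Proof.
move=> sH; have su := past_neq_u sH.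
rewrite {1}/port_target /relabel (negPf su); case: ifP => // /and3P[bu ba bH].
rewrite redirectE tpermD //.
  by apply: contraNneq bH => ->; rewrite -surjective_pairing.
apply: contraTneq ba => E; rewrite negbK.
have Es : port_target N L s.1 s.2 = u by rewrite -E port_toK // N_sym.
case/pastP: sH Es => m mn -> Es.
move: mn; rewrite ltnS leq_eqVlt => /orP[/eqP -> //|mn].
suff : u \in visited L n.+1 by rewrite (negPf u_new).
rewrite -Es -[port_target _ _ _ _]/((step L (state L m)).1) -walk_stateS.
exact: mem_visited.
Qed.

Lemma relabel_state m : m <= n.+1 -> state relabel m = state L m.
Proof.
by apply: eq_walk_state => k kn; apply: relabel_past; exact: mem_past.
Qed.

Lemma relabel_trapped m :
  (state relabel m).1 \in undup (visited L n.+1) ++ u :: N u.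
Proof.
have relu q : port_target N relabel u q = port_target N (fun=> back) u q.
  by rewrite /port_target /relabel eqxx.
(* Invariant of the trapped walk: it replays a past state, stands at [u], or has just left [u]
   through some port [q]. *)
pose Z (s : V * 'I_d) := [\/ s \in past L n.+1, s.1 = u |
  exists q, s = (port_target N relabel u q, ordS q)].
suff : Z (state relabel m).
  case=> [/pastP[k kn ->]|->|[q ->]]; rewrite mem_cat mem_undup.
  - by rewrite mem_visited.
  - by rewrite mem_head orbT.
  - by rewrite inE port_target_in !orbT.
elim: m => [|m IH]; first by apply: Or31; exact: (@mem_past L 0).
rewrite walk_stateS; move: (state relabel m) IH => s.
have Zpast s' : s' \in past L n.+1 -> Z (step relabel s').
  move=> sH; rewrite /step relabel_past //.
  case/pastP: sH => k kn ->.
  rewrite -[(_, _)]/(step L (state L k)) -walk_stateS.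
  move: kn; rewrite ltnS leq_eqVlt => /orP[/eqP ->|kn].
    exact: Or32.
  by apply: Or31; exact: mem_past.
case=> [/Zpast //|su|[q ->]].
  by apply: Or33; exists s.2; rewrite /step su.
set b := port_target _ _ _ _; have bu : b \in N u by exact: port_target_in.
(* Only port [i - 1] of [u] leads to [a], so there the walk resumes its state [(a, i)] of time
   [n]. *)
have [ba|ba] := eqVneq b a.
  apply: Zpast; suff -> : (b, ordS q) = state L n by exact: mem_past.
  suff -> : q = ord_pred i by rewrite ba ord_predK -surjective_pairing.
  apply: (@port_target_inj relabel u); rewrite -/b ba relu.
  by rewrite /port_target redirectE tpermL port_toK.
have pb : port_in b = ordS q.
  congr ordS; apply: (@port_target_inj relabel u).
  by rewrite relu port_toK.
(* At any other neighbour, either the exit port was used before and the past is replayed, or it has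
   been redirected to [u]. *)
have [sH|sH] := boolP ((b, ordS q) \in past L n.+1); first exact: Zpast.
apply: Or32 => /=; rewrite /port_target /relabel.
have -> : b == u = false by apply: contraTF bu => /eqP ->; exact: N_irr.
by rewrite bu ba pb sH redirectE tpermL port_toK // N_sym.
Qed.

Lemma relabel_nvisited m : nvisited relabel m <= nvisited L n.+1 + d.+1.
Proof.
have -> : d.+1 = size (u :: N u) by rewrite /= Hreg.
rewrite -size_cat; apply: uniq_leq_size; first exact: undup_uniq.
by move=> x; rewrite mem_undup => /mapP[k _ ->]; exact: relabel_trapped.
Qed.

End Relabel.

(** Pigeonhole: fewer than [k] vertices offer fewer than [k * d] pairs of a vertex and a port, and a
    repeated state repeats its arc. *)
Lemma nvisited_not_cycles L k : ~ walk_cycles N L v0 l -> k <= nvisited L (k * d).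
Proof.
move=> nc; rewrite leqNgt; apply/negP => nk; apply: nc.
have d0 : 0 < d by case: (d) l => [[]|].
suff /negP nu : ~ uniq (past L (k * d)).
  move/uniqPn: nu => /(_ (v0, l)) [x [y [xy yk E]]]; exists x, y; split=> //.
  move: E yk; rewrite size_map size_iota => E yk.
  move: E; rewrite !(nth_map 0) ?size_iota ?(ltn_trans xy) //.
  by rewrite !nth_iota ?(ltn_trans xy) // !add0n /walk_arc => ->.
move=> up.
have : size (past L (k * d)) <=
    size [seq (x, p) | x <- undup (visited L (k * d)), p <- enum 'I_d].
  apply: uniq_leq_size => // s /pastP[m mk ->].
  rewrite [state L m]surjective_pairing; apply: allpairs_f.
    by rewrite mem_undup mem_visited.
  by rewrite mem_enum.
rewrite size_allpairs size_map size_iota size_enum_ord leq_pmul2r //.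
by rewrite leqNgt nk.
Qed.

(** * Finite balls, which contain all that finitely many steps can see *)

Fixpoint graph_ball n : seq V :=
  if n is n'.+1
  then undup (graph_ball n' ++ flatten [seq N v | v <- graph_ball n'])
  else [:: v0].

Lemma graph_ball_uniq n : uniq (graph_ball n).
Proof. by case: n => [//|n]; exact: undup_uniq. Qed.

Lemma graph_ball_sub m n : m <= n -> {subset graph_ball m <= graph_ball n}.
Proof.
move=> /subnK <-; elim: (n - m) => [//|k IH] v /IH.
by rewrite addSn /= mem_undup mem_cat => ->.
Qed.

Lemma graph_ball_next n v w :
  v \in graph_ball n -> w \in N v -> w \in graph_ball n.+1.
Proof.
move=> vn wv; rewrite /= mem_undup mem_cat; apply/orP; right.
by apply/flattenP; exists (N v); rewrite // map_f.
Qed.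

Lemma walk_graph_ball L n : (state L n).1 \in graph_ball n.
Proof.
elim: n => [|n IH]; first exact: mem_head.
by rewrite walk_stateS; apply: graph_ball_next IH _; exact: port_target_in.
Qed.

(** * Counting the labelings of a ball by the number of visited vertices *)

Section Decay.
Variable T : nat.

Definition ball_labeling := {ffun seq_sub (graph_ball T) -> {perm 'I_d}}.

(** The identity outside the ball is an arbitrary filler: the first [T] steps never read it. *)
Definition ext (g : ball_labeling) : labeling V d := fun v =>
  if insub v is Some x then g x else 1%g.

Definition restr L : ball_labeling := [ffun x => L (val x)].

Lemma ext_restr L v : v \in graph_ball T -> ext (restr L) v = L v.
Proof. by move=> vT; rewrite /ext insubT ffunE. Qed.

Lemma restrP L g :
  restr L = g <-> forall v, v \in graph_ball T -> L v = ext g v.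
Proof.
split=> [<- v vT|E]; first by rewrite ext_restr.
by apply/ffunP => x; rewrite ffunE E ?(valP x) // /ext valK.
Qed.

Lemma ext_restr_state L n : n <= T -> state (ext (restr L)) n = state L n.
Proof.
apply: (@eq_walk_state L _ T) => m mT.
rewrite /port_target ext_restr //; apply: graph_ball_sub (walk_graph_ball _ _).
exact: ltnW.
Qed.

Definition visits_many k : {set ball_labeling} :=
  [set g | k <= nvisited (ext g) T].

(** Relabelling at the discovery of the [k]-th vertex maps [visits_many k] to labelings that visit
    at least [k] but fewer than [k + d.+1] vertices. Recording the old permutations at [u] and its
    [d] neighbours makes this injective. With [1 < k] the discovery time is positive, so the
    discovered vertex has a predecessor. *)
Lemma visits_many_decay k : 1 < k ->
  #|visits_many k| <=
    (#|visits_many k| - #|visits_many (k + d.+1)|) * d`! ^ d.+1.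
Proof.
move=> k1.
(* The [k]-th vertex is discovered at time [(tau g).+1]; the shift makes [tau g] the time of its
   predecessor. *)
pose tau (g : ball_labeling) :=
  find (fun n => discovers (ext g) k n.+1) (iota 0 T).
have tauP g : g \in visits_many k ->
    (tau g).+1 < T /\ discovers (ext g) k (tau g).+1.
  rewrite inE => /(discovers_exists (ltnW k1))[[|n] nT Hn].
    by move: Hn => /andP[_ /(leq_trans k1)].
  have hn : has (fun n => discovers (ext g) k n.+1) (iota 0 T).
    by apply/hasP; exists n; rewrite // mem_iota /=; exact: ltnW.
  have tT : tau g < T by move: hn; rewrite has_find size_iota.
  have Ht : discovers (ext g) k (tau g).+1.
    by have := nth_find 0 hn; rewrite nth_iota.
  by rewrite (discovers_inj Ht Hn).
pose u g := (state (ext g) (tau g).+1).1.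
pose phi g := restr (relabel (ext g) (tau g)).
(* Discovery happens strictly before time [T], so all relabelled vertices lie in the ball and
   restricting to it loses nothing. *)
have u_ball g b : g \in visits_many k -> b \in u g :: N (u g) ->
    b \in graph_ball T.
  move=> /tauP[tT _]; rewrite inE => /orP[/eqP ->|bu].
    exact: graph_ball_sub (ltnW tT) _ (walk_graph_ball _ _).
  apply: (graph_ball_sub tT); apply: graph_ball_next bu.
  exact: walk_graph_ball.
have extphi g : g \in visits_many k ->
    ext (phi g) = relabel (ext g) (tau g).
  move=> gk; apply/boolp.funext => v.
  have [vT|vT] := boolP (v \in graph_ball T).
    exact: ext_restr.
  rewrite relabel_off /ext ?insubN //.
  by apply: contra vT; exact: u_ball.
have phi_state g m : g \in visits_many k -> m <= (tau g).+1 ->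
    state (ext (phi g)) m = state (ext g) m.
  move=> gk mt; rewrite extphi // relabel_state //.
  by have [_ /discovers_new] := tauP _ gk.
have phi_discovers g : g \in visits_many k ->
    discovers (ext (phi g)) k (tau g).+1.
  move=> gk; have [_ ] := tauP _ gk; rewrite /discovers.
  by rewrite !(@eq_nvisited (ext g) (ext (phi g))) // => m mt;
    apply: phi_state => //; rewrite -ltnS // ltnW.
have phi_many g : g \in visits_many k -> phi g \in visits_many k.
  move=> gk; have [tT _] := tauP _ gk; have /andP[_ kt] := phi_discovers _ gk.
  by rewrite inE (leq_trans kt) // nvisited_leq.
have phi_few g : g \in visits_many k -> phi g \notin visits_many (k + d.+1).
  move=> gk; rewrite inE -ltnNge extphi //.
  have [_ Ht] := tauP _ gk; have /andP[tk _] := Ht.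
  apply: leq_ltn_trans (relabel_nvisited (discovers_new Ht) T) _.
  by rewrite ltn_add2r.
(* The walk is unchanged up to the discovery, so [phi g] determines [tau g] and then [u g]. *)
have phi_tau g : g \in visits_many k -> tau (phi g) = tau g.
  move=> gk; have [_ Ht] := tauP _ (phi_many _ gk).
  by case: (discovers_inj Ht (phi_discovers _ gk)).
have phi_u g : g \in visits_many k -> u (phi g) = u g.
  by move=> gk; rewrite /u phi_tau // phi_state.
pose code g :=
  (phi g, [ffun j : 'I_d.+1 => ext g (nth (u g) (u g :: N (u g)) j)]).
have code_inj : {in visits_many k &, injective code}.
  move=> g h gk hk [E1 E2].
  have Eu : u g = u h by rewrite -phi_u // E1 phi_u.
  transitivity (restr (ext h)); [apply/esym|]; apply/restrP => //.
  (* On [u g] and its neighbours the recorded permutations decide; elsewhere the relabelling changed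
     nothing. *)
  move=> v vT; have [vu|vu] := boolP (v \in u g :: N (u g)).
    have jd : index v (u g :: N (u g)) < d.+1.
      by rewrite -(Hreg (u g)) -[X in _ < X]/(size (u g :: N (u g))) index_mem.
    move/ffunP: E2 => /(_ (Ordinal jd)); rewrite !ffunE -Eu.
    by rewrite nth_index // => ->.
  have := congr1 ext E1; rewrite !extphi // => /(congr1 (fun L => L v)).
  by rewrite !relabel_off -/(u _) -?Eu.
rewrite -[leqLHS](card_in_imset code_inj).
have <- : #|visits_many k :\: visits_many (k + d.+1)| =
    #|visits_many k| - #|visits_many (k + d.+1)|.
  rewrite cardsD; congr (_ - #|pred_of_set _|); apply/finset.setIidPr.
  apply/fintype.subsetP => g; rewrite !inE.
  by apply: leq_trans; exact: leq_addr.
have <- : #|[set: {ffun 'I_d.+1 -> {perm 'I_d}}]| = d`! ^ d.+1.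
  rewrite cardsT card_ffun card_ord; congr (_ ^ _).
  exact: card_perm_ord.
rewrite -cardsX; apply/subset_leq_card/fintype.subsetP => _ /imsetP[g gk ->].
rewrite finset.in_setX finset.in_setT andbT finset.in_setD.
by rewrite phi_few ?phi_many.
Qed.

End Decay.
End Start.
End Walk.

Local Open Scope classical_set_scope.
Local Open Scope ring_scope.

(** * From counting to probability *)

Lemma card_ball_labeling (V : choiceType) (N : V -> seq V) (d : nat) (v0 : V)
    (T : nat) :
  #|{: ball_labeling N d v0 T}| = (d`! ^ size (graph_ball N v0 T))%N.
Proof.
rewrite card_ffun card_seq_sub ?graph_ball_uniq //; congr (_ ^ _)%N.
exact: card_perm_ord.
Qed.

Section Random.
Variables (V : choiceType) (N : V -> seq V) (d : nat).
Hypotheses (Hsimple : simple_graph N) (Hreg : regular N d).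
Variables (dsp : measure_display) (Omega : measurableType dsp) (R : realType).
Variables (P : probability Omega R) (L : Omega -> labeling V d).
Hypothesis Hrand : random_labeling P L.
Variables (v0 : V) (l : 'I_d).

Let cylinderE T g : [set w | restr N v0 T (L w) = g] =
  [set w | forall v, v \in graph_ball N v0 T -> L w v = ext g v].
Proof. by apply/seteqP; split=> w /= /restrP. Qed.

Let measurable_cylinder T g : measurable [set w | restr N v0 T (L w) = g].
Proof.
rewrite cylinderE.
rewrite (_ : mkset _ =
  \bigcap_(v in [set` graph_ball N v0 T]) [set w | L w v = ext g v]) //.
by apply: fin_bigcap_measurable => // v _; exact: (Hrand.1).
Qed.

Let restr_bigcup T (A : {set ball_labeling N d v0 T}) :
  [set w | restr N v0 T (L w) \in A] =
  \bigcup_(g in [set` enum A]) [set w | restr N v0 T (L w) = g].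
Proof.
apply/seteqP; split=> w /=; last by case=> g /= + ->; rewrite mem_enum.
by move=> wA; exists (restr N v0 T (L w)); rewrite //= mem_enum.
Qed.

Lemma measurable_restr T (A : {set ball_labeling N d v0 T}) :
  measurable [set w | restr N v0 T (L w) \in A].
Proof. by rewrite restr_bigcup; apply: fin_bigcup_measurable. Qed.

(** The restricted labeling is uniform: its fibres are disjoint cylinders over the distinct vertices
    of the ball, all equally likely. *)
Lemma probability_restr T (A : {set ball_labeling N d v0 T}) :
  P [set w | restr N v0 T (L w) \in A] =
  (#|A|%:R / #|{: ball_labeling N d v0 T}|%:R)%:E.
Proof.
rewrite restr_bigcup measure_fin_bigcup //; last first.
  by move=> g h _ _ [w [/= <- <-]].
rewrite -fsbig_seq ?enum_uniq //.
rewrite (eq_bigr (fun=> ((d`!%:R : R)^-1 ^+ size (graph_ball N v0 T))%:E));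
  last by move=> g _; rewrite cylinderE; apply: Hrand.2; exact: graph_ball_uniq.
rewrite sumEFin big_const_seq count_predT -cardE iter_addr_0.
by rewrite card_ball_labeling natrX exprVn mulr_natl.
Qed.

Lemma measurable_walk_cycles : measurable [set w | walk_cycles N (L w) v0 l].
Proof.
rewrite (_ : mkset _ = \bigcup_n \bigcup_(m in [set m | (n < m)%N])
    [set w | walk_arc N (L w) v0 l n = walk_arc N (L w) v0 l m]); last first.
  apply/seteqP; split=> w /=.
    by case=> n [m [nm E]]; exists n => //; exists m.
  by case=> n _ [m /= nm E]; exists n, m.
apply: bigcup_measurable => n _; apply: bigcup_measurable => m /= nm.
(* Arc [m] ends at the vertex of time [m.+1], so the labeling of the ball of that radius decides the
   event. *)
rewrite (_ : mkset _ = [set w | restr N v0 m.+1 (L w) \in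
  [set g | walk_arc N (ext g) v0 l n == walk_arc N (ext g) v0 l m]%SET]).
  exact: measurable_restr.
have arcE w k : (k <= m)%N ->
    walk_arc N (ext (restr N v0 m.+1 (L w))) v0 l k = walk_arc N (L w) v0 l k.
  move=> km; rewrite /walk_arc.
  have := @ext_restr_state _ _ _ Hreg v0 l m.+1 (L w) k.
  have := @ext_restr_state _ _ _ Hreg v0 l m.+1 (L w) k.+1.
  rewrite !ltnS !walk_stateS /step => /(_ km) + /(_ (leqW km)) Ek.
  by rewrite Ek; case: walk_state => x p [->].
by apply/seteqP; split=> w /=; rewrite inE !arcE ?(ltnW nm) // => /eqP.
Qed.

(** The decay [x <= (x - y) * C] rearranges to [y <= (1 - C^-1) * x]. The iteration starts at [2]
    because the decay requires [1 < k]. *)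
Lemma visits_many_geometric T j :
  #|visits_many N v0 l T (2 + j * d.+1)|%:R / #|{: ball_labeling N d v0 T}|%:R
    <= (1 - ((d`! ^ d.+1)%:R)^-1) ^+ j :> R.
Proof.
set C := (d`! ^ d.+1)%N; set q := 1 - _.
have C0 : (0 < C%:R :> R) by rewrite ltr0n expn_gt0 fact_gt0.
have B0 : (0 < #|{: ball_labeling N d v0 T}|%:R :> R).
  by rewrite ltr0n card_ball_labeling expn_gt0 fact_gt0.
have q0 : 0 <= q by rewrite subr_ge0 invf_le1 // ler1n expn_gt0 fact_gt0.
rewrite ler_pdivrMr //; elim: j => [|j IH].
  by rewrite mul1r ler_nat max_card.
set k := (2 + j * d.+1)%N in IH.
have -> : (2 + j.+1 * d.+1 = k + d.+1)%N by rewrite /k mulSn (addnC d.+1) addnA.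
rewrite exprS -mulrA; apply: le_trans (ler_wpM2l q0 IH).
have := visits_many_decay Hsimple Hreg v0 l T (k := k) isT.
rewrite -(ler_nat R) natrM natrB; last first.
  apply/subset_leq_card/fintype.subsetP => g.
  by rewrite !inE; apply: leq_trans; exact: leq_addr.
rewrite -ler_pdivrMr // /q mulrBl mul1r mulrC; lra.
Qed.

Lemma walk_cycles_as : P [set w | walk_cycles N (L w) v0 l] = 1%E.
Proof.
have mC := measurable_walk_cycles.
set E := mkset _ in mC *.
have mN : measurable (~` E) by exact: measurableC.
set q : R := 1 - ((d`! ^ d.+1)%:R)^-1.
have Nle j : (P (~` E) <= (q ^+ j)%:E)%E.
  (* Within [k * d] steps a walk that never cycles visits [k] vertices, which the ball of radius [T]
     detects. *)
  pose k := (2 + j * d.+1)%N; pose T := (k * d)%N.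
  apply: (@le_trans _ _
      (P [set w | restr N v0 T (L w) \in visits_many N v0 l T k])).
    apply: le_measure; rewrite ?inE //; first exact: measurable_restr.
    move=> w /= nc; rewrite inE.
    rewrite (@eq_nvisited _ _ _ _ _ (L w)); first exact: nvisited_not_cycles.
    by move=> m mT; apply: ext_restr_state => //; exact: ltnW.
  by rewrite probability_restr lee_fin visits_many_geometric.
have C1 : 1 <= (d`! ^ d.+1)%:R :> R by rewrite ler1n expn_gt0 fact_gt0.
have Ci0 : 0 < ((d`! ^ d.+1)%:R : R)^-1 by rewrite invr_gt0 (lt_le_trans ltr01).
have Ci1 : ((d`! ^ d.+1)%:R : R)^-1 <= 1.
  by rewrite invf_le1 // (lt_le_trans ltr01).
have q1 : `|q| < 1 by rewrite ger0_norm /q; lra.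
suff PN0 : P (~` E) = 0%E.
  have := probability_setC P mN; rewrite setCK => ->.
  by rewrite PN0 sube0.
have fP := fin_num_measure P _ mN.
apply/eqP; rewrite eq_le measure_ge0 andbT -(fineK fP) lee_fin leNgt.
(* Were the probability positive, some [q ^+ j] would fall below it, against [Nle]. *)
apply/negP => P0.
have [j _ /(_ j (leqnn j))] := cvgr_lt _ (cvg_expr q1) _ P0.
by rewrite ltNge -lee_fin fineK // Nle.
Qed.

End Random.

Theorem theorem4p4 (V : countType) (N : V -> seq V) (d : nat)
    (dsp : measure_display) (Omega : measurableType dsp) (R : realType)
    (P : probability Omega R) (L : Omega -> labeling V d)
    (Hsimple : simple_graph N) (Hreg : regular N d)
    (Hconn : connected_graph N) (Hinf : infinite_type V)
    (Hrand : random_labeling P L)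
    (v0 : V) (l : 'I_d) :
  measurable [set w | walk_cycles N (L w) v0 l] /\
  P [set w | walk_cycles N (L w) v0 l] = 1%E.
Proof.
split; first exact: measurable_walk_cycles Hrand _ _.
exact: walk_cycles_as Hrand _ _.
Qed.
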